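(* Let $F$ be an algebraic extension of $\mathbb{F}_p$ for some prime $p$. For $n\ge 2$, the ring of polynomials $F[x_1,\dots,x_n]$ is a hereditarily atomic domain whose quotient field is not hereditarily atomic.
   Context: An integral domain is atomic if every nonzero nonunit element factors into (finitely many) irreducible elements. An integral domain $R$ is hereditarily atomic if every subring of $R$ (with the same identity) is atomic. Here $F$ is a field and $x_1,\dots,x_n$ are distinct indeterminates. *)

(* Defs.v *)
From HB Require Import structures.
From mathcomp Require Import all_boot all_order all_algebra.
From mathcomp Require Import mpoly.
Set Implicit Arguments.
Unset Strict Implicit.
Unset Printing Implicit Defensive.
Import GRing.Theory.
Local Open Scope ring_scope.

(* Subrings of R are Prop-valued predicates rather than {pred R}, so that no
   decidability of membership is imposed.  Units, irreducibles and atomicity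
   are relative to the subring S: a unit of R lying in S need not be one of S. *)
Section Atomicity.

Variable R : idomainType.
Implicit Types (S : R -> Prop) (x y z a : R).

Definition subring S : Prop :=
  [/\ S 1,
      forall x y, S x -> S y -> S (x - y)
    & forall x y, S x -> S y -> S (x * y)].

Definition unit_in S x : Prop := S x /\ exists2 y, S y & x * y = 1.

Definition irreducible_in S x : Prop :=
  [/\ S x, x <> 0, ~ unit_in S x
    & forall y z, S y -> S z -> x = y * z -> unit_in S y \/ unit_in S z].

Definition atomic_in S : Prop :=
  forall x, S x -> x <> 0 -> ~ unit_in S x ->
  exists2 s : seq R,
    (forall a, a \in s -> irreducible_in S a) & x = \prod_(a <- s) a.

End Atomicity.

Definition hereditarily_atomic (R : idomainType) : Prop :=
  forall S : R -> Prop, subring S -> atomic_in S.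

(* Main.v *)
Require Import Defs.
From HB Require Import structures.
From mathcomp Require Import all_boot all_order all_algebra.
From mathcomp Require Import mpoly.
From mathcomp Require Import ring.
From Stdlib Require Import Classical.
Set Implicit Arguments.
Unset Strict Implicit.
Unset Printing Implicit Defensive.
Import GRing.Theory.
Local Open Scope ring_scope.

(** The two halves are independent.

    Atomicity of every subring [S] of F[x_1, ..., x_n] is an induction on the
    total degree, which is additive on products.  The only danger is a nonunit
    of [S] of degree 0, since splitting it off would not lower the degree.  Such
    an element is a nonzero constant [c] of F; being algebraic over a finite
    field, [c] is a root of unity, so its inverse is a power of [c] and already
    lies in [S].  Hence both factors of a proper factorization in [S] have
    strictly smaller degree ([torsion_degree0_hereditarily_atomic],
    [algebraic_over_finite_torsion]).

    For the quotient field, write x and y for two of the variables, and let phi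
    send x to X and every other variable to 0.  It extends to a morphism from
    F[x_1, ..., x_n][1/x] to F[X, 1/X]; let [S] be the preimage of F[X], and
    [P] the kernel, which is a prime ideal of [S].  As P = x P and x is not a
    unit of [S], no element of [P] is irreducible; and as [P] is prime, no
    element of [P] is a product of irreducibles.  But y is a nonzero element of
    [P] ([fraction_not_hereditarily_atomic]). *)

(** * Subrings of polynomial rings *)

Lemma subringX (R : idomainType) (S : R -> Prop) x m :
  subring S -> S x -> S (x ^+ m).
Proof.
case=> S1 _ SM Sx; elim: m => [|m IHm]; first by rewrite expr0.
by rewrite exprS; apply: SM.
Qed.

(** The hypothesis on elements of degree 0 is what passes to subrings: it puts
    their inverses in every subring that contains them, which being units of
    [R] would not. *)
Lemma torsion_degree0_hereditarily_atomic (R : idomainType) (deg : R -> nat) :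
    (forall x y, x != 0 -> y != 0 -> deg (x * y) = (deg x + deg y)%N) ->
    (forall x, x != 0 -> deg x = 0%N -> exists m, x ^+ m.+1 = 1) ->
  hereditarily_atomic R.
Proof.
move=> degM deg0 S subS x.
have degS z : S z -> z != 0 -> ~ unit_in S z -> (0 < deg z)%N.
  move=> Sz z0 nuz; rewrite lt0n; apply/eqP => /(deg0 z z0)[m zm].
  by apply: nuz; split=> //; exists (z ^+ m); [exact: subringX|rewrite -exprS].
have [b] := ubnP (deg x); elim: b => // b IHb in x *; rewrite ltnS => lexb.
move=> Sx /eqP x0 nux.
have [irrx|redx] := classic (irreducible_in S x).
  by exists [:: x]; rewrite ?big_seq1 // => a; rewrite inE => /eqP->.
have [y [z [Sy Sz xE nuy nuz]]] :
    exists y z, [/\ S y, S z, x = y * z, ~ unit_in S y & ~ unit_in S z].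
  apply: NNPP => nofact; apply: redx; split=> //; first exact/eqP.
  move=> y z Sy Sz xE; apply: NNPP => /not_or_and[nuy nuz].
  by apply: nofact; exists y, z.
have [y0 z0] : y != 0 /\ z != 0.
  by apply/andP; rewrite -negb_or -mulf_eq0 -xE.
have dy := degS _ Sy y0 nuy; have dz := degS _ Sz z0 nuz.
move: lexb; rewrite xE degM // => lexb.
have [||s irrs ->] := IHb y _ Sy _ nuy; [|exact/eqP|].
  by apply: leq_trans lexb; rewrite -addn1 leq_add2l.
have [||t irrt ->] := IHb z _ Sz _ nuz; [|exact/eqP|].
  by apply: leq_trans lexb; rewrite -add1n leq_add2r.
exists (s ++ t); last by rewrite big_cat.
by move=> a; rewrite mem_cat => /orP[/irrs|/irrt].
Qed.

(** If [q] annihilates [a], then every power of [a] is the value at [a] of a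
    polynomial reduced modulo [q].  Over a finite base field there are only
    finitely many such remainders, so two distinct powers coincide. *)
Lemma algebraic_over_finite_torsion (K : finFieldType) (F : fieldType)
    (iota : {rmorphism K -> F}) (a : F) :
  algebraicOver iota a -> a != 0 -> exists m, a ^+ m.+1 = 1.
Proof.
case=> q q0 qa0 a0.
pose coord (i : 'I_(#|{: 'rV[K]_(size q)}|.+1)) : 'rV[K]_(size q) :=
  poly_rV ('X^i %% q).
have powE i : a ^+ i = (map_poly iota ('X^i %% q)).[a].
  have := congr1 (fun r => (map_poly iota r).[a]) (divp_eq 'X^i q).
  rewrite rmorphD rmorphM /= map_polyXn hornerD hornerM hornerXn => ->.
  by rewrite (rootP qa0) mulr0 add0r.
have /injectivePn[i [j neij eqij]] : ~~ injectiveb coord.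
  by apply/injectiveP => /leq_card; rewrite card_ord ltnn.
have eqX : a ^+ i = a ^+ j.
  have szmod k : (size ('X^k %% q)%R <= size q)%N by rewrite ltnW ?ltn_modpN0.
  rewrite !powE -(poly_rV_K (szmod i)) -(poly_rV_K (szmod j)).
  by rewrite -/(coord i) eqij.
clear eqij; wlog ltij : i j neij eqX / (i < j)%N.
  move=> IH; have [ltij|ltji|eqij] := ltngtP i j; first exact: IH ltij.
    by apply: IH ltji; rewrite // eq_sym.
  by rewrite (val_inj eqij) eqxx in neij.
exists (j - i.+1)%N; rewrite -subSn // subSS.
apply: (mulIf (expf_neq0 i a0)).
by rewrite mul1r -exprD subnK ?eqX // ltnW.
Qed.

Lemma mpoly_hereditarily_atomic (K : finFieldType) (F : fieldType)
    (iota : {rmorphism K -> F}) (n : nat) :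
  (forall a : F, algebraicOver iota a) -> hereditarily_atomic {mpoly F[n]}.
Proof.
move=> algF.
apply: (@torsion_degree0_hereditarily_atomic _ (fun f => (msize f).-1)).
  move=> f g f0 g0; rewrite msizeM //.
  by rewrite (mpolySpred mdeg f0) (mpolySpred mdeg g0) addnS.
move=> f f0 deg0; have /msize_poly1P[c c0 ->] : msize f == 1%N.
  by rewrite (mpolySpred mdeg f0) deg0.
have [m cm] := algebraic_over_finite_torsion (algF c) c0.
by exists m; rewrite -rmorphXn cm.
Qed.

(** * A nonatomic subring of a field of fractions *)

Section PullbackSubring.

Variables (A B : idomainType) (phi : {rmorphism A -> B}) (x : A).
Hypothesis phix0 : phi x != 0.

Local Notation K := {fraction A}.
Local Notation emb := (@tofrac A).

(** [pullback] is the preimage of [B] under the extension A[1/x] -> B[1/phi x]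
    of [phi], and [pullback_ker] is the kernel of this extension.  Both describe
    [z] by a numerator [h], to avoid constructing the localizations. *)
Definition pullback (z : K) : Prop :=
  exists k h b, z * emb x ^+ k = emb h /\ phi h = phi x ^+ k * b.

Definition pullback_ker (z : K) : Prop :=
  exists k h, z * emb x ^+ k = emb h /\ phi h = 0.

Let embx0 : emb x != 0.
Proof. by rewrite tofrac_eq0; apply: contraNneq phix0 => ->; rewrite rmorph0. Qed.

Lemma pullback_subring : subring pullback.
Proof.
split.
- by exists 0%N, 1, 1; rewrite !mulr1 !rmorph1 expr0.
- move=> z w [k [h [b [zE hE]]]] [l [g [c [wE gE]]]].
  exists (k + l)%N, (h * x ^+ l - g * x ^+ k), (b - c); split.
    by rewrite rmorphB !rmorphM !rmorphXn /= exprD -zE -wE; ring.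
  by rewrite rmorphB !rmorphM !rmorphXn /= exprD hE gE; ring.
- move=> z w [k [h [b [zE hE]]]] [l [g [c [wE gE]]]].
  exists (k + l)%N, (h * g), (b * c); split.
    by rewrite rmorphM /= exprD -zE -wE; ring.
  by rewrite rmorphM /= exprD hE gE; ring.
Qed.

Lemma pullback_emb h : pullback (emb h).
Proof. by exists 0%N, h, (phi h); rewrite !expr0 mulr1 mul1r. Qed.

Lemma pullback_ker_sub z : pullback_ker z -> pullback z.
Proof. by case=> k [h [zE h0]]; exists k, h, 0; rewrite mulr0. Qed.

Lemma pullback_ker1 : ~ pullback_ker 1.
Proof.
case=> k [h []]; rewrite mul1r -tofracXn => /eqP; rewrite tofrac_eq => /eqP <-.
by move/eqP; rewrite rmorphXn expf_eq0 (negPf phix0) andbF.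
Qed.

Lemma pullback_kerM z w : pullback_ker z -> pullback w -> pullback_ker (z * w).
Proof.
case=> k [h [zE h0]] [l [g [c [wE _]]]]; exists (k + l)%N, (h * g).
by rewrite !rmorphM /= h0 mul0r -zE -wE exprD; split=> //; ring.
Qed.

Lemma pullback_ker_prime z w :
  pullback z -> pullback w -> pullback_ker (z * w) ->
  pullback_ker z \/ pullback_ker w.
Proof.
case=> k [h [b [zE _]]] [l [g [c [wE _]]]] [m [f [zwE f0]]].
have /eqP : h * g * x ^+ m = f * x ^+ (k + l).
  apply/eqP; rewrite -tofrac_eq !tofracM !tofracXn -zE -wE -zwE.
  by rewrite exprD; apply/eqP; ring.
move/eqP/(congr1 phi)/eqP; rewrite !rmorphM !rmorphXn /= f0 mul0r.
rewrite !mulf_eq0 expf_eq0 (negPf phix0) andbF orbF => /orP[]/eqP ?.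
  by left; exists k, h.
by right; exists l, g.
Qed.

Lemma pullback_ker_nonunit z : pullback_ker z -> ~ unit_in pullback z.
Proof.
by move=> Pz [_ [w Sw zw1]]; apply: pullback_ker1; rewrite -zw1; apply: pullback_kerM.
Qed.

Lemma pullback_x_nonunit : phi x \isn't a GRing.unit -> ~ unit_in pullback (emb x).
Proof.
move=> nux [_ [w [l [g [c [wE gE]]]] xw1]].
have xg : x ^+ l = x * g.
  by apply/eqP; rewrite -tofrac_eq tofracM -wE mulrA xw1 mul1r tofracXn.
move/negP: nux; apply; apply/unitrPr; exists c.
apply: (mulfI (expf_neq0 l phix0)); rewrite mulr1.
by rewrite mulrCA -gE -rmorphM -xg rmorphXn.
Qed.

(** An element [z] of the kernel splits as [x * (z / x)], and [z / x] is in the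
    kernel again. *)
Lemma pullback_ker_reducible z :
  phi x \isn't a GRing.unit -> pullback_ker z -> ~ irreducible_in pullback z.
Proof.
move=> nux Pz [_ _ _ irrz].
have Pzx : pullback_ker (z / emb x).
  have [k [h [zE h0]]] := Pz; exists k.+1, h; split=> //.
  by rewrite exprS mulrA divfK.
have zE : z = emb x * (z / emb x) by rewrite mulrC divfK.
have [] := irrz _ _ (pullback_emb x) (pullback_ker_sub Pzx) zE.
  exact: pullback_x_nonunit.
exact: pullback_ker_nonunit.
Qed.

Lemma pullback_ker_prod (s : seq K) :
    (forall a, a \in s -> pullback a) -> pullback_ker (\prod_(a <- s) a) ->
  exists2 a, a \in s & pullback_ker a.
Proof.
have [S1 _ SM] := pullback_subring.
elim: s => [|a s IHs] Ss; first by rewrite big_nil => /pullback_ker1.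
have Sa : pullback a by apply: Ss; rewrite mem_head.
have {}Ss b : b \in s -> pullback b by move=> sb; apply: Ss; rewrite inE sb orbT.
have Sprod : pullback (\prod_(b <- s) b).
  by rewrite big_seq; apply: big_ind => // b /Ss.
rewrite big_cons => /(pullback_ker_prime Sa Sprod)[Pa|/(IHs Ss)[b sb Pb]].
  by exists a; rewrite ?mem_head.
by exists b; rewrite ?inE ?sb ?orbT.
Qed.

Lemma fraction_not_hereditarily_atomic y :
    phi x \isn't a GRing.unit -> phi y = 0 -> y != 0 ->
  ~ hereditarily_atomic K.
Proof.
move=> nux phiy0 y0 /(_ _ pullback_subring (emb y)) atom_y.
have Py : pullback_ker (emb y) by exists 0%N, y; rewrite expr0 mulr1.
have [||s irrs yE] := atom_y (pullback_emb y).
- by apply/eqP; rewrite tofrac_eq0.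
- exact: pullback_ker_nonunit.
have Ss a : a \in s -> pullback a by case/irrs.
have [|a sa Pa] := pullback_ker_prod Ss; first by rewrite -yE.
exact: pullback_ker_reducible (irrs a sa).
Qed.

End PullbackSubring.

Lemma mpoly_fraction_not_hereditarily_atomic (F : fieldType) (n : nat) :
  (2 <= n)%N -> ~ hereditarily_atomic {fraction {mpoly F[n]}}.
Proof.
case: n => [|[|n]] // _.
pose i0 : 'I_n.+2 := ord0; pose i1 : 'I_n.+2 := lift ord0 ord0.
pose subst (i : 'I_n.+2) : {poly F} := if i == i0 then 'X else 0.
pose phi : {rmorphism {mpoly F[n.+2]} -> {poly F}} := mmap polyC subst.
have phiX i : phi 'X_i = subst i by rewrite /phi /= mmapX mmap1U.
apply: (@fraction_not_hereditarily_atomic _ _ phi 'X_i0 _ 'X_i1).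
- by rewrite phiX polyX_eq0.
- by rewrite phiX poly_unitE size_polyX.
- by rewrite phiX.
- by rewrite -msize_poly_eq0 msizeX.
Qed.

Theorem corollary5p5 (p : nat) (hp : prime p) (F : fieldType)
    (iota : {rmorphism 'F_p -> F}) (hF : forall a : F, algebraicOver iota a)
    (n : nat) (hn : (2 <= n)%N) :
  hereditarily_atomic {mpoly F[n]} /\
  ~ hereditarily_atomic {fraction {mpoly F[n]}}.
Proof.
split; first exact: mpoly_hereditarily_atomic hF.
exact: mpoly_fraction_not_hereditarily_atomic.
Qed.
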